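(* Let $\mathcal T$ be a reduced T-mesh, $\mathbf r$ a smoothness distribution on $\mathcal T$ that is constant along each maximal segment, and $m,m'\ge0$ integers. The weighted CNDC $\operatorname{CNDC}_{m,m'}^{\mathbf r}(\mathcal T)$ is independent of the order in which eligible MISs are removed. That is: consider any process that starts from the state $(\operatorname{MIS}(\mathcal T),\varnothing)$, at each step chooses a nonempty set of MISs that are diagonalizable at the current state $(\mathcal A,\mathcal B)$ and moves them from $\mathcal A$ to $\mathcal B$, and stops only when no MIS in $\mathcal A$ is diagonalizable at $(\mathcal A,\mathcal B)$. Then its final remaining set $\mathcal A$ equals $\operatorname{CNDC}_{m,m'}^{\mathbf r}(\mathcal T)$.
   Context: **T-meshes.** Coordinates on $\mathbb R^2$ are $(s,t)$, with $s$ horizontal and $t$ vertical. Let $\Omega\subset\mathbb R^2$ be a finite union of closed axis-aligned rectangles with pairwise disjoint interiors, with $\Omega$ simply connected and $\Omega^\circ$ connected. A T-mesh on $\Omega$ is a triple $\mathcal T=(\mathcal T_2,\mathcal T_1,\mathcal T_0)$: $\mathcal T_2$ is the finite set of these closed rectangles (cells); $\mathcal T_1=\mathcal T_1^h\cup\mathcal T_1^v$ is a finite set of closed horizontal and vertical segments (edges) contained in $\bigcup_{\sigma\in\mathcal T_2}\partial\sigma$; $\mathcal T_0$ is the set of endpoints of edges (vertices); each $\partial\sigma$ is a finite union of edges; distinct cells $\sigma,\sigma'$ satisfy $\sigma\cap\sigma'=\partial\sigma\cap\partial\sigma'$, a finite union of edges and vertices; distinct edges meet only in vertices. Interior edges $\mathcal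 T_1^\circ$ are the edges meeting $\Omega^\circ$; the other edges are boundary edges. Interior vertices $\mathcal T_0^\circ$ are the vertices in $\Omega^\circ$. **Maximal segments.** A segment is a connected union of edges lying on one straight line. $\operatorname{MS}(\mathcal T)$ is the set of maximal segments consisting of interior edges. Such a segment is a cross-cut if both endpoints lie on $\partial\Omega$, a ray if exactly one does, and a maximal interior segment (MIS) if it does not meet $\partial\Omega$; $\operatorname{MIS}(\mathcal T)=\operatorname{MIS}_h(\mathcal T)\cup\operatorname{MIS}_v(\mathcal T)$ (horizontal/vertical). A boundary maximal segment is a maximal connected union of boundary edges on one line. $\widehat{\operatorname{MS}}(\mathcal T)$ is the set of all cross-cuts, rays, MISs and boundary maximal segments. $\mathcal T$ is reduced if no vertex is inserted merely to divide a straight edge into two collinear edges, every vertex lies on exactly one horizontal and exactly one vertical member of $\widehat{\operatorname{MS}}(\mathcal T)$, and the edges are exactly the closed subsegments between consecutive vertices on these members (so an interior and a boundary maximal segment of the same direction never meet collinearly at a common endpoint). **Smoothness.** A smoothness distribution is a map $\mathbf r:\mathcal T_1\to\{-1,0,1,\dots\}$ equal to $-1$ on boundary edges. It is constant along each maximal segment if for every $\rho\in\operatorname{MS}(\mathcal T)$ all edges $\tau\subset\rho$ have the same value $\mathbf r(\tau)=:r(\rho)$. For $\gamma\in\mathcal T_0^\circ$ with horizontal and vertical maximal segments $\rho_h(\gamma),\rho_v(\gamma)$ through it, $r_h(\gamma):=r(\rho_v(\gamma))$ and $r_v(\gamma):=r(\rho_h(\gamma))$. **Absolute weights.** A deletion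 state is a pair $(\mathcal A,\mathcal B)$ with $\mathcal A\cap\mathcal B=\varnothing$, $\mathcal A\cup\mathcal B=\operatorname{MIS}(\mathcal T)$. For $\rho\in\mathcal A$, $\operatorname{Mono}_{(\mathcal A,\mathcal B)}(\rho)$ is the set of vertices on $\rho$ lying on no MIS in $\mathcal A\setminus\{\rho\}$. With $(a)_+=\max\{a,0\}$, $\mu_h(\gamma)=(m-r_h(\gamma))_+$, $\mu_v(\gamma)=(m'-r_v(\gamma))_+$. The absolute weight $\Omega_{(\mathcal A,\mathcal B)}(\rho)$ is $\sum_{\gamma\in\operatorname{Mono}_{(\mathcal A,\mathcal B)}(\rho)}\mu_h(\gamma)$ for $\rho$ horizontal and $\sum_{\gamma\in\operatorname{Mono}_{(\mathcal A,\mathcal B)}(\rho)}\mu_v(\gamma)$ for $\rho$ vertical. The threshold is $\theta(\rho)=m+1$ for $\rho$ horizontal, $m'+1$ for $\rho$ vertical. An MIS $\rho\in\mathcal A$ is diagonalizable (eligible for removal) at $(\mathcal A,\mathcal B)$ if $\Omega_{(\mathcal A,\mathcal B)}(\rho)\ge\theta(\rho)$. **Deletion algorithm and weighted CNDC.** Start with $\mathcal A=\operatorname{MIS}(\mathcal T)$, $\mathcal B=\varnothing$. In each pass let $\mathcal Z$ be the set of all $\rho\in\mathcal A$ diagonalizable at $(\mathcal A,\mathcal B)$, and replace $\mathcal A$ by $\mathcal A\setminus\mathcal Z$ and $\mathcal B$ by $\mathcal B\cup\mathcal Z$; repeat until a pass has $\mathcal Z=\varnothing$. The final $\mathcal A$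 is the weighted CNDC $\operatorname{CNDC}_{m,m'}^{\mathbf r}(\mathcal T)$ and the final $\mathcal B$ is $\operatorname{Diag}_{m,m'}^{\mathbf r}(\mathcal T)$. *)

(* Defs.v *)
From HB Require Import structures.
From mathcomp Require Import all_boot all_order all_algebra finmap.
From mathcomp Require Import mathcomp_extra boolp classical_sets functions.
From mathcomp Require Import cardinality fsbigop set_interval reals topology.
From mathcomp Require Import normedtype.

Set Implicit Arguments.
Unset Strict Implicit.
Unset Printing Implicit Defensive.

Import Order.TTheory GRing.Theory Num.Theory numFieldNormedType.Exports.

Local Open Scope classical_set_scope.
Local Open Scope ring_scope.

(* The plane is R * R with coordinates (s, t) = (x.1, x.2). Cells, edges and
   maximal segments are all represented by their sets of points. *)

Section plane.
Variable R : realType.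
Implicit Types (S : set (R * R)) (a b c d : R).

Definition boundary S := closure S `\` interior S.

Definition rectangle a b c d : set (R * R) := `[a, b] `*` `[c, d].

Definition hsegment t a b : set (R * R) := `[a, b] `*` [set t].

Definition vsegment s a b : set (R * R) := [set s] `*` `[a, b].

Definition is_rectangle S :=
  exists a b c d, [/\ a < b, c < d & S = rectangle a b c d].

Definition is_hsegment S := exists t a b, a < b /\ S = hsegment t a b.

Definition is_vsegment S := exists s a b, a < b /\ S = vsegment s a b.

Definition endpoints S : set (R * R) := [set x | exists c a b, a < b /\
  ((S = hsegment c a b /\ (x = (a, c) \/ x = (b, c))) \/
   (S = vsegment c a b /\ (x = (c, a) \/ x = (c, b))))].

Definition on_hline S := exists t, S `<=` [set x | x.2 = t].

Definition on_vline S := exists s, S `<=` [set x | x.1 = s].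

Definition is_path_in S (f : R -> R * R) :=
  {within `[0, 1], continuous f} /\ f @` `[0, 1] `<=` S.

Definition path_connected S := forall x y, S x -> S y ->
  exists f, [/\ is_path_in S f, f 0 = x & f 1 = y].

Definition null_homotopic_in S (f : R -> R * R) :=
  exists H : R * R -> R * R,
    [/\ {within `[0, 1] `*` `[0, 1], continuous H},
        H @` (`[0, 1] `*` `[0, 1]) `<=` S,
        (forall u, u \in `[0, 1] -> H (0, u) = f u /\ H (1, u) = f 0) &
        (forall v, v \in `[0, 1] -> H (v, 0) = f 0 /\ H (v, 1) = f 0)].

Definition simply_connected S := path_connected S /\
  forall f, is_path_in S f -> f 0 = f 1 -> null_homotopic_in S f.

End plane.

Definition union_of {T : Type} (F : set (set T)) (S : set T) :=
  exists2 E, E `<=` F & S = \bigcup_(e in E) e.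

Record tmesh (R : realType) := TMesh {
  cells : set (set (R * R));
  hedges : set (set (R * R));
  vedges : set (set (R * R));
  edges := hedges `|` vedges;
  vertices := \bigcup_(e in edges) endpoints e;
  domain := \bigcup_(c in cells) c;
  finite_cells : finite_set cells;
  cells_rectangle : forall c, cells c -> is_rectangle c;
  cells_disjoint : forall c c', cells c -> cells c' -> c <> c' ->
    interior c `&` interior c' = set0;
  domain_simply_connected : simply_connected domain;
  domain_interior_connected : connected (interior domain);
  finite_hedges : finite_set hedges;
  finite_vedges : finite_set vedges;
  hedges_segment : forall e, hedges e -> is_hsegment e;
  vedges_segment : forall e, vedges e -> is_vsegment e;
  edges_boundary : forall e, edges e ->
    e `<=` \bigcup_(c in cells) boundary c;
  boundary_edges_cell : forall c, cells c -> union_of edges (boundary c);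
  cells_meet : forall c c', cells c -> cells c' -> c <> c' ->
    c `&` c' = boundary c `&` boundary c' /\
    union_of (edges `|` [set [set v] | v in vertices]) (c `&` c');
  edges_meet : forall e e', edges e -> edges e' -> e <> e' ->
    e `&` e' `<=` vertices }.

Section mesh.
Variables (R : realType) (T : tmesh R).
Implicit Types (rho e : set (R * R)) (g : R * R).

Definition interior_edges : set (set (R * R)) :=
  [set e | edges T e /\ e `&` interior (domain T) !=set0].

Definition boundary_edges : set (set (R * R)) := edges T `\` interior_edges.

Definition interior_vertices : set (R * R) :=
  vertices T `&` interior (domain T).

(* Edges being axis-parallel, a line containing one of them is horizontal or
   vertical. *)
Definition segment_of (F : set (set (R * R))) rho :=
  [/\ rho !=set0, union_of F rho, connected rho &
      on_hline rho \/ on_vline rho].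

Definition maximal_segment_of (F : set (set (R * R))) rho :=
  segment_of F rho /\
  forall rho', segment_of F rho' -> rho `<=` rho' -> rho' = rho.

Definition MS : set (set (R * R)) :=
  [set rho | maximal_segment_of interior_edges rho].

Definition cross_cut rho :=
  MS rho /\ endpoints rho `<=` boundary (domain T).

Definition ray rho :=
  MS rho /\ exists! g, endpoints rho g /\ boundary (domain T) g.

Definition MIS : set (set (R * R)) :=
  [set rho | MS rho /\ rho `&` boundary (domain T) = set0].

Definition boundary_MS : set (set (R * R)) :=
  [set rho | maximal_segment_of boundary_edges rho].

Definition MShat : set (set (R * R)) :=
  [set rho | [\/ cross_cut rho, ray rho, MIS rho | boundary_MS rho]].

Definition dividing_vertex g := vertices T g /\
  exists e e', [/\ e <> e',
    [set a | edges T a /\ a g] = [set e; e'] &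
    (hedges T e /\ hedges T e') \/ (vedges T e /\ vedges T e')].

Definition reduced :=
  [/\ forall g, ~ dividing_vertex g,
      forall g, vertices T g ->
        (exists! rho, [/\ MShat rho, on_hline rho & rho g]) /\
        (exists! rho, [/\ MShat rho, on_vline rho & rho g]),
      hedges T = [set e | exists rho t a b,
        [/\ MShat rho, on_hline rho, a < b, e = hsegment t a b & e `<=` rho] /\
        [/\ vertices T (a, t), vertices T (b, t) &
            forall c, a < c < b -> ~ vertices T (c, t)]] &
      vedges T = [set e | exists rho s a b,
        [/\ MShat rho, on_vline rho, a < b, e = vsegment s a b & e `<=` rho] /\
        [/\ vertices T (s, a), vertices T (s, b) &
            forall c, a < c < b -> ~ vertices T (s, c)]]].

(* Only the values of r on the edges of T are used. *)
Variable r : set (R * R) -> int.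

Definition smoothness_distribution :=
  (forall e, edges T e -> -1 <= r e) /\
  (forall e, boundary_edges e -> r e = -1).

Definition constant_along_segments := forall rho, MS rho ->
  forall e e', edges T e -> edges T e' -> e `<=` rho -> e' `<=` rho ->
    r e = r e'.

(* For a reduced mesh with constant smoothness, xget is only relevant on
   maximal segments and interior vertices, where it selects the unique value;
   its default is arbitrary. *)
Definition segment_smoothness rho : int :=
  xget (-1) [set r e | e in [set e | edges T e /\ e `<=` rho]].

Definition rho_h g : set (R * R) :=
  xget set0 [set rho | [/\ MS rho, on_hline rho & rho g]].

Definition rho_v g : set (R * R) :=
  xget set0 [set rho | [/\ MS rho, on_vline rho & rho g]].

Definition r_h g : int := segment_smoothness (rho_v g).

Definition r_v g : int := segment_smoothness (rho_h g).

Variables m m' : nat.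

Definition mu_h g : int := Num.max (m%:Z - r_h g) 0.

Definition mu_v g : int := Num.max (m'%:Z - r_v g) 0.

Definition state : Type := (set (set (R * R)) * set (set (R * R)))%type.

Definition deletion_state (st : state) :=
  st.1 `&` st.2 = set0 /\ st.1 `|` st.2 = MIS.

Definition Mono (st : state) rho : set (R * R) :=
  [set g | [/\ vertices T g, rho g &
               forall rho', st.1 rho' -> rho' <> rho -> ~ rho' g]].

Definition absolute_weight (st : state) rho : int :=
  if `[< on_hline rho >] then \sum_(g \in Mono st rho) mu_h g
  else \sum_(g \in Mono st rho) mu_v g.

Definition threshold rho : int :=
  if `[< on_hline rho >] then m.+1%:Z else m'.+1%:Z.

Definition diag_MIS (st : state) : set (set (R * R)) :=
  [set rho | st.1 rho /\ threshold rho <= absolute_weight st rho].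

Definition delete (Z : set (set (R * R))) (st : state) : state :=
  (st.1 `\` Z, st.2 `|` Z).

Definition initial_state : state := (MIS, set0).

(* deletion_run st st' : started at st, the loop deleting in each pass all the
   diagonalizable MISs halts at st'. *)
Inductive deletion_run : state -> state -> Prop :=
| deletion_halt st : diag_MIS st = set0 -> deletion_run st st
| deletion_pass st st' : diag_MIS st !=set0 ->
    deletion_run (delete (diag_MIS st) st) st' -> deletion_run st st'.

(* By deletion_run_final below, final_state is the unique outcome of the
   algorithm, so the default value of xget is never used. *)
Definition final_state : state :=
  xget (set0, set0) [set st | deletion_run initial_state st].

Definition CNDC : set (set (R * R)) := final_state.1.

Definition Diag : set (set (R * R)) := final_state.2.

Inductive removal_process : state -> Prop :=
| removal_start : removal_process initial_state
| removal_step st Z : removal_process st -> Z !=set0 ->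
    Z `<=` diag_MIS st -> removal_process (delete Z st).

Lemma removal_process_state st : removal_process st -> deletion_state st.
Proof.
elim=> [|{}st Z _ [dA uA] _ sZ]; first by split; rewrite /= ?setI0 ?setU0.
have sZA : Z `<=` st.1 by move=> x /sZ[].
split; apply/seteqP; split=> //= x.
- move=> [[Ax nZ] [Bx|//]].
  by have : (st.1 `&` st.2) x by []; rewrite dA.
- by rewrite -uA => -[[Ax _]|[Bx|/sZA Ax]]; [left|right|left].
- rewrite -uA => -[Ax|Bx]; last by right; left.
  by have [Zx|nZx] := pselect (Z x); [right; right|left].
Qed.

Lemma finite_MIS : finite_set MIS.
Proof.
have fE : finite_set (edges T).
  by rewrite finite_setU; split; [exact: finite_hedges|exact: finite_vedges].
have /finite_fsetP[X EX] := fE.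
apply: (@sub_finite_set _ _
  [set \bigcup_(e in [set` Y]) e | Y in [set` fpowerset X]]); last first.
  exact/finite_image/finite_fset.
move=> rho [[[_ [E sE ->] _ _] _] _] /=.
have fsE : finite_set E by apply: sub_finite_set fE => e /sE[].
exists (fset_set E); last by rewrite fset_setK.
rewrite /= fpowersetE; apply/fsubsetP => e.
by rewrite in_fset_set// inE => /sE[]; rewrite EX.
Qed.

Lemma deletion_run_det st st1 st2 :
  deletion_run st st1 -> deletion_run st st2 -> st1 = st2.
Proof.
move=> run1; elim: run1 st2 => {st st1} [st Z0|st st1 Z0 _ IH] st2 run2.
  by case: run2 Z0 => // st' ? [x Zx] _ Z0; move: Zx; rewrite Z0.
case: run2 Z0 IH => [st' -> [? []]//|st' st2' _ run2 _ IH]; exact: IH.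
Qed.

Lemma deletion_run_exists st : finite_set st.1 ->
  exists st', deletion_run st st'.
Proof.
have [n] := ubnP #|` fset_set st.1|%fset.
elim: n st => // n IH st /ltnSE len fst1.
have [Z0|/set0P Z0] := eqVneq (diag_MIS st) set0.
  by exists st; apply: deletion_halt.
have fst2 : finite_set (delete (diag_MIS st) st).1.
  by apply: sub_finite_set fst1 => x [].
have [|//|st' run] := IH (delete (diag_MIS st) st).
  apply: leq_trans len; apply: fproper_ltn_card.
  rewrite fproperEneq; apply/andP; split; last first.
    by rewrite -fset_set_sub// => x [].
  apply/eqP => /(congr1 (fun X => [set` X])); rewrite !fset_setK//.
  by move: Z0 => [x [Ax tx]] /= E; move: (Ax); rewrite -E => -[_]; apply.
by exists st'; apply: deletion_pass run.
Qed.

Lemma deletion_run_final : deletion_run initial_state final_state.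
Proof.
have [st run] := deletion_run_exists (st := initial_state) finite_MIS.
exact: (@xgetI _ (set0, set0) [set st | deletion_run initial_state st] st run).
Qed.

End mesh.

(* Main.v *)
Require Import Defs.
From mathcomp Require Import all_boot all_order all_algebra.
From mathcomp Require Import boolp classical_sets reals.
From mathcomp Require Import cardinality fsbigop real_interval.

(** Deleting MISs from the first component of a state only enlarges the sets
    [Mono], hence the weights, as the [mu]s are nonnegative. So an MIS that is
    removed by one process at some state is still diagonalizable, if present,
    at any state with fewer remaining MISs. Inductively, a process never removes
    an MIS that survives in a state where nothing is diagonalizable; applying
    this to two terminating processes in both directions gives equality. *)

Import Order.TTheory GRing.Theory Num.Theory.

Local Open Scope classical_set_scope.

Lemma fst_setX_image (A B : Type) (X : set A) (Y : set B) :
  Y !=set0 -> fst @` (X `*` Y) = X.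
Proof.
move=> [y Yy]; apply/seteqP; split=> [_ [p [Xp _] <-]//|x Xx].
by exists (x, y).
Qed.

Lemma snd_setX_image (A B : Type) (X : set A) (Y : set B) :
  X !=set0 -> snd @` (X `*` Y) = Y.
Proof.
move=> [x Xx]; apply/seteqP; split=> [_ [p [_ Yp] <-]//|y Yy].
by exists (x, y).
Qed.

(* The endpoints are the two corners of the bounding box of [S]. *)
Lemma finite_endpoints (R : realType) (S : set (R * R)) :
  finite_set (endpoints S).
Proof.
apply: (@sub_finite_set _ _ [set (inf (fst @` S), inf (snd @` S));
                                 (sup (fst @` S), sup (snd @` S))]); last first.
  by rewrite finite_setU; split; exact: finite_set1.
move=> x [c [a [b [ab SE]]]].
(* A projection of a product recovers its factor only if the other factor is nonempty. *)
have ab0 : `[a, b] !=set0 by exists a; rewrite /= in_itv/= lexx ltW.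
have c0 : [set c] !=set0 by exists c.
case: SE => -[-> xE].
- rewrite /hsegment fst_setX_image// snd_setX_image//.
  by rewrite inf1 sup1 sup_itvcc ?inf_itvcc ?ltW.
- rewrite /vsegment fst_setX_image// snd_setX_image//.
  by rewrite inf1 sup1 sup_itvcc ?inf_itvcc ?ltW.
Qed.

Lemma finite_vertices (R : realType) (T : tmesh R) : finite_set (vertices T).
Proof.
apply: bigcup_finite => [|e _]; last exact: finite_endpoints.
by rewrite finite_setU; split; [exact: finite_hedges|exact: finite_vedges].
Qed.

(** The part of the sum over [B] outside [A] is nonnegative. Finiteness matters: a sum with infinite
    support defaults to 0. *)
Lemma le_fsum_subset (R : numDomainType) (I : choiceType) (A B : set I)
    (f : I -> R) :
  finite_set B -> A `<=` B -> (forall i, 0 <= f i)%R ->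
  (\sum_(i \in A) f i <= \sum_(i \in B) f i)%R.
Proof.
move=> finB /setIidPr AB f0; rewrite [leRHS](fsbigID A)// AB lerDl.
exact: fsumr_ge0.
Qed.

Section removal.
Variables (R : realType) (T : tmesh R) (r : set (R * R) -> int) (m m' : nat).
Implicit Types st : state R.

Lemma subset_Mono st st' rho : st'.1 `<=` st.1 ->
  Mono T st rho `<=` Mono T st' rho.
Proof.
by move=> sA g [Vg rg Mg]; split=> // rho' /sA Arho'; exact: Mg.
Qed.

Lemma le_absolute_weight st st' rho : st'.1 `<=` st.1 ->
  (absolute_weight T r m m' st rho <= absolute_weight T r m m' st' rho)%R.
Proof.
move=> sA; have finM : finite_set (Mono T st' rho).
  by apply: sub_finite_set (finite_vertices _ T) => g [].
rewrite /absolute_weight; case: ifP => _; apply: le_fsum_subset => //.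
- exact: subset_Mono.
- by move=> g; rewrite le_max lexx orbT.
- exact: subset_Mono.
- by move=> g; rewrite le_max lexx orbT.
Qed.

Lemma stuck_subset_removal st st' : removal_process T r m m' st ->
  st'.1 `<=` MIS T -> diag_MIS T r m m' st' = set0 -> st'.1 `<=` st.1.
Proof.
move=> + sMIS stuck; elim=> // {}st Z _ sA _ sZ rho A'rho.
split; first exact: sA.
(* If [rho] were in [Z], its weight at [st] would reach the threshold, hence also its weight at
   [st'], which has no more remaining MISs. *)
move=> /sZ[_ wrho]; suff : diag_MIS T r m m' st' rho by rewrite stuck.
by split=> //; exact: le_trans wrho (le_absolute_weight _ _ _ sA).
Qed.

Lemma removal_process_MIS st : removal_process T r m m' st -> st.1 `<=` MIS T.
Proof. by move=> /removal_process_state[_ <-] rho Arho; left. Qed.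

(** Each pass is a removal step with [Z] the whole of [diag_MIS], so the algorithm is itself one of
    the competing processes. *)
Lemma deletion_run_removal st st' : deletion_run T r m m' st st' ->
  removal_process T r m m' st ->
  removal_process T r m m' st' /\ diag_MIS T r m m' st' = set0.
Proof.
elim=> {st st'} [//|st st' Z0 _ IH proc]; apply: IH.
exact: removal_step.
Qed.

End removal.

Theorem theorem3p17 (R : realType) (T : tmesh R) (r : set (R * R) -> int)
    (m m' : nat) :
  reduced T ->
  smoothness_distribution T r ->
  constant_along_segments T r ->
  forall st : state R,
    removal_process T r m m' st ->
    diag_MIS T r m m' st = set0 ->
    st.1 = CNDC T r m m'.
Proof.
move=> _ _ _ st proc stuck.
have [procF stuckF] := deletion_run_removal _ _ _ _ _ _ _
  (deletion_run_final T r m m') (removal_start _ _ _ _).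
apply/seteqP; split.
(* Here the algorithm is the process and [st] the stuck state; the other inclusion swaps the
   roles. *)
- apply: (stuck_subset_removal _ _ _ _ _ _ _ procF _ stuck).
  by move/removal_process_MIS: proc.
- apply: (stuck_subset_removal _ _ _ _ _ _ _ proc _ stuckF).
  by move/removal_process_MIS: procF.
Qed.
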